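(* Let $I$ be a nonempty set and let $F$ be the free group freely generated by $\{x_i \mid i\in I\}$. Let $\varphi : F \to F$ be an automorphism satisfying $$\varphi(x_i) = w_i\,x_{\sigma(i)}\,w_i^{-1}\quad\text{for all } i \in I,$$ where $w_i \in F$ for each $i\in I$ and $\sigma: I\to I$ is a bijection. Assume that $\sigma(i_0) = i_0$ for some $i_0\in I$, and let $h:F\to \mathbb{Z}$ be the homomorphism defined by $h(x_{i_0}) = 1$ and $h(x_j) =0$ for all $j \neq i_0$. Assume that for each finite orbit $\mathcal O$ of $\sigma$ we have $$\gcd\Big(|\mathcal{O}|,\ \sum_{i \in \mathcal{O}} h(w_i)\Big)=1.$$ Then there exists a bi-ordering of $F$ invariant under $\varphi$.
   Context: A bi-ordering of a group $G$ is a strict total ordering $<$ of $G$ such that $f<g$ implies $hf<hg$ and $fh<gh$ for all $f,g,h\in G$. It is invariant under an automorphism $\varphi:G\to G$ if for all $f,g\in G$: $f<g$ if and only if $\varphi(f)<\varphi(g)$. For a bijection $\sigma:I\to I$, the orbit of $x\in I$ is $\{\sigma^n(x)\mid n\in\mathbb Z\}$; an orbit is finite if it has finite cardinality. By convention $\gcd(1,0)=1$. *)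

(* Defs.v *)
From HB Require Import structures.
From mathcomp Require Import all_boot all_order all_algebra.
From mathcomp Require Import finmap.
From mathcomp Require Import boolp classical_sets functions cardinality fsbigop.

Set Implicit Arguments.
Unset Strict Implicit.
Unset Printing Implicit Defensive.

Import GRing.Theory.

Local Open Scope classical_set_scope.
Local Open Scope ring_scope.

(* F is the free group freely generated by the family x (universal property). *)
Definition freely_generates (I : Type) (F : groupType) (x : I -> F) : Prop :=
  forall (G : groupType) (f : I -> G),
    exists2 g : {multiplicative F -> G},
      forall i, g (x i) = f i
      & forall g' : {multiplicative F -> G},
          (forall i, g' (x i) = f i) -> g' =1 g.

Definition bi_ordering (G : groupType) (lt : rel G) : Prop :=
  [/\ irreflexive lt,
      transitive lt,
      forall f g, f != g -> lt f g || lt g f,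
      forall f g h, lt f g -> lt (h * f)%g (h * g)%g
    & forall f g h, lt f g -> lt (f * h)%g (g * h)%g].

Definition invariant_under (G : groupType) (phi : G -> G) (lt : rel G) : Prop :=
  forall f g, lt f g <-> lt (phi f) (phi g).

(* The n-th power of a bijection s whose inverse is t; [Negz k] is - k.+1. *)
Definition iterz (I : Type) (s t : I -> I) (n : int) : I -> I :=
  match n with
  | Posz k => iter k s
  | Negz k => iter k.+1 t
  end.

Definition orbitz (I : Type) (s t : I -> I) (i : I) : set I :=
  [set iterz s t n i | n in [set: int]].

(* Main.v *)
Require Import Defs.
From HB Require Import structures.
From mathcomp Require Import all_boot all_order all_algebra.
From mathcomp Require Import finmap.
From mathcomp Require Import boolp classical_sets functions cardinality fsbigop.
From mathcomp Require Import wochoice ring zify.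

(** Write t for x_i0 and K for the kernel of h. Since sigma fixes i0, phi
    preserves h, so F is an extension of Z by K on which phi induces the
    identity of Z. It is therefore enough to order K biinvariantly, in a way
    that is preserved by conjugation by t and by phi, and to call g positive
    if h g > 0, or if h g = 0 and g is positive in K.

    The kernel is free on the elements y (i, n) = t^n x_i t^-n with i <> i0
    and n an integer. In its abelianization, a free abelian group, conjugation
    by t and phi permute this basis: the former by (i, n) |-> (i, n + 1), the
    latter by (i, n) |-> (sigma i, n + h (w_i)), because conjugation by w_i
    only matters there through h (w_i). These two permutations commute, so
    they define an action of Z x Z on the basis. The stabilizer of a point
    over an infinite orbit of sigma is trivial; over a finite orbit of length
    l, with k the sum of the h (w_i), it is generated by (l, - k). The gcd
    condition says exactly that the quotient of Z x Z by this subgroup is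
    torsion-free, hence infinite cyclic, so that each orbit of the action
    carries an invariant total order (orbit_coord), and so does the whole
    basis (exists_skew_order).

    From the basis the order is carried to K by the Magnus expansion, which
    sends y b to 1 + b in the noncommutative power series over the basis. It
    is injective (magnus_faithful), and the coefficients of a given degree of
    an element of K have finite support (coef_support). Ordering words by
    length and then lexicographically, an element of K is positive if the
    coefficient of the first nonempty word of its expansion is. In the lowest
    positive degree the expansion turns products into sums, whence positive
    elements form a semigroup.

    It remains to see that an endomorphism psi acting on the abelianization
    by a permutation Psi of the basis acts on lowest degree terms by applying
    Psi letterwise (coef_equivariant). This would be clear from substituting
    in the power series, but the basis is infinite, and such a substitution
    need not converge. Instead, the coefficient of the word Psi u in psi k and
    the coefficient of u in k are both polynomial functions of k, of degree
    the length of u and with the same differences of top order. Their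
    difference has smaller degree, and by a finite Taylor formula (taylor) a
    function of degree less than n is constant on the elements whose
    coefficients in degrees 1, ..., n - 1 vanish. *)

Set Implicit Arguments.
Unset Strict Implicit.
Unset Printing Implicit Defensive.

Import Order.TTheory GRing.Theory Num.Theory.

Local Open Scope classical_set_scope.
Local Open Scope ring_scope.

(** * Integer iterates and integer powers *)

Lemma int_shift_ind (P : int -> Prop) :
  P 0 -> (forall n, P n -> P (n + 1)) -> (forall n, P (n + 1) -> P n) ->
  forall n, P n.
Proof.
move=> P0 Pup Pdn; case=> k; elim: k => [|k IHk] //.
- by rewrite -addn1 PoszD; apply: Pup.
- by apply: Pdn.
by apply: Pdn; rewrite (_ : Negz k.+1 + 1 = Negz k) //; lia.
Qed.

Lemma iterzS (T : Type) (s t : T -> T) (tK : cancel t s) n i :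
  iterz s t (n + 1) i = s (iterz s t n i).
Proof.
case: n => [n|[|n]]; first by rewrite addrC.
  by rewrite (_ : Negz 0 + 1 = 0) //= tK.
by rewrite (_ : Negz n.+1 + 1 = Negz n) ?[RHS]/= ?tK //; lia.
Qed.

Lemma iterzD (T : Type) (s t : T -> T) (sK : cancel s t) (tK : cancel t s)
  n m i : iterz s t (n + m) i = iterz s t n (iterz s t m i).
Proof.
elim/int_shift_ind: n => [|n IHn|n IHn]; first by rewrite add0r.
  by rewrite addrAC !iterzS // IHn.
by apply: (can_inj sK); rewrite -!iterzS // addrAC.
Qed.

Lemma iterzB (T : Type) (s t : T -> T) (sK : cancel s t) (tK : cancel t s)
  n m i j : iterz s t n i = iterz s t m j <-> iterz s t (n - m) i = j.
Proof.
have D := iterzD sK tK.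
split=> [e|<-]; last by rewrite -D addrC subrK.
by rewrite addrC D e -D addNr.
Qed.

Definition zpow (G : groupType) (g : G) (n : int) : G :=
  iterz ( *%g g) ( *%g g^-1%g) n 1%g.

Lemma zpow0 (G : groupType) (g : G) : zpow g 0 = 1%g.
Proof. by []. Qed.

Lemma zpowS (G : groupType) (g : G) n : zpow g (n + 1) = (g * zpow g n)%g.
Proof. by apply: iterzS; apply: mulVKg. Qed.

Lemma zpowD (G : groupType) (g : G) n m :
  zpow g (n + m) = (zpow g n * zpow g m)%g.
Proof.
elim/int_shift_ind: n => [|n IHn|n IHn]; first by rewrite add0r zpow0 mul1g.
  by rewrite addrAC !zpowS IHn mulgA.
by apply: (mulgI g); rewrite -zpowS addrAC IHn zpowS mulgA.
Qed.

Lemma zpow1 (G : groupType) (g : G) : zpow g 1 = g.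
Proof. by rewrite -[1]add0r zpowS zpow0 mulg1. Qed.

Lemma zpowN (G : groupType) (g : G) n : zpow g (- n) = (zpow g n)^-1%g.
Proof. by apply/esym/mulg1_eq; rewrite -zpowD subrr. Qed.

Lemma morph_one (G H : groupType) (f : {multiplicative G -> H}) :
  f 1%g = 1%g.
Proof. by apply: (mulgI (f 1%g)); rewrite -gmulfM !mulg1. Qed.

Lemma morph_inv (G H : groupType) (f : {multiplicative G -> H}) g :
  f g^-1%g = (f g)^-1%g.
Proof. by apply/esym/mulg1_eq; rewrite -gmulfM mulgV morph_one. Qed.

Lemma zpow_morph (G H : groupType) (f : {multiplicative G -> H}) g n :
  f (zpow g n) = zpow (f g) n.
Proof.
elim/int_shift_ind: n => [|n IHn|n IHn]; first by rewrite !zpow0 morph_one.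
  by rewrite !zpowS gmulfM IHn.
by apply: (mulgI (f g)); rewrite -zpowS -IHn zpowS gmulfM.
Qed.

(** * Generators of a free group *)

(** The subgroup as a group in its own right, to which the universal property
    of F can be applied. *)
Definition subgrp (G : groupType) (S : {pred G}) (S_closed : group_closed S) :=
  {g : G | S g}.

HB.instance Definition _ (G : groupType) (S : {pred G})
  (S_closed : group_closed S) :=
  SubChoice.copy (subgrp S_closed) {g : G | S g}.
HB.instance Definition _ (G : groupType) (S : {pred G})
  (S_closed : group_closed S) :=
  SubChoice_isSubGroup.Build G S (subgrp S_closed) S_closed.

(** The universal property yields a morphism g from F to the subgroup S of
    the elements satisfying P; its composition with the inclusion of S fixes
    the generators, hence is the identity, so S is all of F. *)
Lemma free_ind (I : Type) (F : groupType) (x : I -> F) :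
  freely_generates x -> forall P : F -> Prop,
  P 1%g -> (forall u v, P u -> P v -> P (u * v)%g) ->
  (forall u, P u -> P u^-1%g) -> (forall i, P (x i)) -> forall u, P u.
Proof.
move=> x_free P P1 PM PV Px u.
pose S : {pred F} := fun g => `[< P g >].
have S_closed : group_closed S.
  split; first exact/asboolP.
  by move=> a b /asboolP Pa /asboolP Pb; apply/asboolP/PM => //; apply: PV.
pose xS i : subgrp S_closed := Sub (x i) (asboolT (Px i)).
have [g gx _] := x_free _ xS.
have [g0 _ g0_uniq] := x_free _ x.
have := g0_uniq idfun (fun=> erefl) u.
rewrite -(g0_uniq (val \o g)) => [/= ->|i /=]; first exact/asboolP/(valP (g u)).
by rewrite gx SubK.
Qed.

(** * The group of permutations of a type *)

Record permt (T : Type) := Permt {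
  pfun : T -> T;
  pinv : T -> T;
  pfunK : cancel pfun pinv;
  pinvK : cancel pinv pfun }.

Lemma permt_eq (T : Type) (p q : permt T) : pfun p = pfun q -> p = q.
Proof.
case: p q => [f f' fK f'K] [g g' gK g'K] /= fg; subst g.
have ff' : f' = g' by apply/funext => y; rewrite -[in LHS](g'K y) fK.
by subst g'; congr Permt; apply: Prop_irrelevance.
Qed.

HB.instance Definition _ (T : Type) := gen_eqMixin (permt T).
HB.instance Definition _ (T : Type) := gen_choiceMixin (permt T).

Section PermtGroup.
Context (T : Type).
Implicit Types p q : permt T.

Definition permt1 : permt T :=
  @Permt T id id (fun=> erefl) (fun=> erefl).
Definition permtM p q : permt T :=
  Permt (can_comp (pfunK p) (pfunK q)) (can_comp (pinvK q) (pinvK p)).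
Definition permtV p : permt T := Permt (pinvK p) (pfunK p).

Lemma permtA : associative permtM.
Proof. by move=> p q r; apply: permt_eq. Qed.
Lemma permt1M : left_id permt1 permtM.
Proof. by move=> p; apply: permt_eq. Qed.
Lemma permtM1 : right_id permt1 permtM.
Proof. by move=> p; apply: permt_eq. Qed.
Lemma permtVM : left_inverse permt1 permtV permtM.
Proof. by move=> p; apply: permt_eq; apply/funext => y; apply: pfunK. Qed.
Lemma permtMV : right_inverse permt1 permtV permtM.
Proof. by move=> p; apply: permt_eq; apply/funext => y; apply: pinvK. Qed.

End PermtGroup.

HB.instance Definition _ (T : Type) :=
  isGroup.Build (permt T) (@permtA T) (@permt1M T) (@permtM1 T)
    (@permtVM T) (@permtMV T).

(** * Orders on I x Z invariant under a skew permutation *)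

Definition strict_total (T : eqType) (lt : rel T) : Prop :=
  [/\ irreflexive lt, transitive lt & forall a b, a != b -> lt a b || lt b a].

(** A well-ordering of T, made strict. *)
Lemma exists_strict_total (T : eqType) : exists lt : rel T, strict_total lt.
Proof.
have [R Rwo] := well_ordering_principle T.
have Rwc : @wo_chain T R predT by move=> A _; apply: Rwo.
have Rtot a b : R a b || R b a by apply: (wo_chainW Rwc).
have Rasym a b : R a b -> R b a -> a = b.
  by move=> ab ba; apply: (wo_chain_antisymmetric Rwc) => //; rewrite ab ba.
exists (fun a b => ~~ R b a); split.
- by move=> a; rewrite (wo_chain_reflexive Rwc).
- move=> b a c /= nba ncb; apply/negP => Rca.
  have /Rwo [m [[mabc mmin] _]] : nonempty (mem [:: a; b; c]).
    by exists a; rewrite inE /= inE eqxx.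
  have [Rma Rmb Rmc] : [/\ R m a, R m b & R m c].
    by split; apply: mmin; rewrite inE /= !inE eqxx ?orbT.
  (* A minimum of the three elements contradicts one of the hypotheses. *)
  move: mabc Rma Rmb Rmc; rewrite inE /= !inE.
  case/or3P=> /eqP -> Ra Rb Rc.
  + by move: ncb; rewrite (Rasym _ _ Rca Rc) Rb.
  + by rewrite Ra in nba.
  + by rewrite Rb in ncb.
move=> a b ab; rewrite -negb_and; apply: contra ab => /andP[ba ab].
by apply/eqP/Rasym.
Qed.

(** The permutation induced by phi on the basis of the abelianized kernel,
    with a i = h (w i), and its inverse. *)
Definition skew (I : Type) (s : I -> I) (a : I -> int) (b : I * int) : I * int :=
  (s b.1, b.2 + a b.1).
Definition skewV (I : Type) (sV : I -> I) (a : I -> int) (b : I * int) :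
  I * int := (sV b.1, b.2 - a (sV b.1)).

Section SkewOrder.
Context (I : choiceType) (s sV : I -> I).
Hypotheses (sK : cancel s sV) (sVK : cancel sV s).
Context (a : I -> int).
Hypothesis orbit_gcd : forall i, let O := orbitz s sV i in
  finite_set O -> gcdz (#|` fset_set O|%fset)%:Z (\sum_(j \in O) a j) = 1.

Local Notation Phi := (skew s a).
Local Notation PhiV := (skewV sV a).
Local Notation Phiz := (iterz Phi PhiV).
Local Notation sz := (iterz s sV).

Lemma skewK : cancel Phi PhiV.
Proof. by case=> i n; rewrite /skew /skewV /= sK addrK. Qed.

Lemma skewVK : cancel PhiV Phi.
Proof. by case=> i n; rewrite /skew /skewV /= sVK subrK. Qed.

Let PhizS := iterzS skewVK.
Let PhizD := iterzD skewK skewVK.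

Lemma skewz1 p b : (Phiz p b).1 = sz p b.1.
Proof.
elim/int_shift_ind: p => [//|p IHp|p IHp]; first by rewrite PhizS iterzS //= IHp.
by apply: (can_inj sK); rewrite -[RHS]iterzS // -IHp PhizS.
Qed.

Lemma skewzD p i n m :
  Phiz p (i, n + m) = ((Phiz p (i, n)).1, (Phiz p (i, n)).2 + m).
Proof.
elim/int_shift_ind: p => [//|p IHp|p IHp].
  by rewrite !PhizS IHp /skew /= addrAC.
by apply: (can_inj skewK); rewrite -PhizS IHp PhizS /skew /= addrAC.
Qed.

Lemma skewz_period i l k : Phiz l (i, 0) = (i, k) ->
  forall c q, Phiz (c * l) (i, q) = (i, q + c * k).
Proof.
move=> lk.
have step q : Phiz l (i, q) = (i, q + k).
  by rewrite -[q in LHS]add0r skewzD lk addrC.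
elim/int_shift_ind=> [q|c IHc q|c IHc q]; first by rewrite !mul0r addr0.
  by rewrite mulrDl mul1r PhizD step IHc; congr pair; ring.
have := IHc (q - k); rewrite mulrDl mul1r PhizD step subrK => ->.
by congr pair; ring.
Qed.

(** The orbit of (r, 0) under Z x Z, in which (p, q) acts by Phi^p followed by
    the translation by q, is embedded in Z x Z by (p, q) |-> (k p + l q, u p).
    If r has an infinite orbit under s, the stabilizer is trivial and (q, p)
    will do. Otherwise l is the length of the orbit of r and k the sum of a
    over it, and u = 0; the stabilizer is generated by (l, - k), which is the whole
    kernel of (p, q) |-> k p + l q because l and k are coprime. *)
Lemma orbit_coord (r : I) : exists l k u : int, forall p q p' q',
  Phiz p (r, q) = Phiz p' (r, q') <->
  (k * p + l * q = k * p' + l * q' /\ u * p = u * p').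
Proof.
have PhizB := iterzB skewK skewVK.
have [[n0 [n0_gt0 n0r]]|aperiodic] :=
    pselect (exists n, (0 < n)%N /\ iter n s r = r); last first.
  exists 1, 0, 1 => p q p' q'; rewrite !mul0r !add0r !mul1r; split=> [|[-> ->] //].
  move=> /PhizB/[dup] eqq /(congr1 fst); rewrite skewz1 /= => fixr.
  have pp' : p - p' = 0.
    case: (p - p') fixr => [[//|n]|n] fixr; first by case: aperiodic; exists n.+1.
    case: aperiodic; exists n.+1; split => //.
    rewrite -[in LHS]fixr /=.
    by have := iterzD sK sVK (Posz n.+1) (Negz n) r; rewrite NegzE subrr /= => <-.
  by move: eqq; rewrite pp' => -[->]; move/eqP: pp'; rewrite subr_eq0 => /eqP.
have exl : exists n, (0 < n)%N && (iter n s r == r).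
  by exists n0; rewrite n0_gt0 n0r eqxx.
case: (ex_minnP exl) => l /andP[l_gt0 /eqP lr] l_min.
pose tr := [seq iter m s r | m <- iota 0 l].
have szl : sz l r = r by [].
have szM c : sz (c * l%:Z) r = r.
  elim/int_shift_ind: c => [|c IHc|c IHc]; first by rewrite mul0r.
    by rewrite mulrDl mul1r iterzD // szl IHc.
  by move: IHc; rewrite mulrDl mul1r iterzD // szl.
have sz_mod p : sz p r = iter `|(p %% l)%Z|%N s r.
  rewrite [in LHS](divz_eq p l) addrC iterzD // szM.
  by rewrite -[(p %% l)%Z in LHS]gez0_abs // modz_ge0 // -lt0n.
have mod_lt p : (`|(p %% l)%Z| < l)%N.
  by rewrite -ltz_nat gez0_abs ?modz_ge0 ?ltz_pmod // -?lt0n.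
have dvd_l p : sz p r = r -> (l %| p)%Z.
  rewrite sz_mod => fixr; apply/dvdz_mod0P/eqP; rewrite -absz_eq0 eqn0Ngt.
  apply/negP => mod_gt0; have := l_min `|(p %% l)%Z|%N.
  by rewrite mod_gt0 fixr eqxx leqNgt mod_lt => /(_ isT).
(* tr lists the orbit once, so that its length and the sum of a over it are
   those of the hypothesis on orbits. *)
have tr_uniq : uniq tr.
  rewrite map_inj_in_uniq ?iota_uniq // => m m'; rewrite !mem_iota /= !add0n.
  move=> ml m'l eqm.
  have /dvd_l : sz (m%:Z - m'%:Z) r = r by apply/(iterzB sK sVK).
  by rewrite -eqz_mod_dvd !modz_small ?lez0_nat ?ltz_nat // => /eqP [].
have trE : orbitz s sV r = [set` tr].
  rewrite predeqE => i; split=> [[p _ <-]|/= /mapP[m _ ->]]; last by exists m%:Z.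
  by rewrite sz_mod; apply: map_f; rewrite mem_iota /= add0n mod_lt.
have := @orbit_gcd r; rewrite /= trE => /(_ (finite_seq _)).
have -> : [set` tr] = [set` [fset i in tr]%fset].
  by rewrite predeqE => i; rewrite /= inE.
rewrite set_fsetK card_fseq undup_id // size_map size_iota.
have -> : [set` [fset i in tr]%fset] = [set` tr].
  by rewrite predeqE => i; rewrite /= inE.
rewrite -fsbig_seq // big_map => gcd_lk.
set k := \sum_(_ <- _) _ in gcd_lk.
have PhizM := @skewz_period r l k _.
have Phizl : Phiz l (r, 0) = (r, k).
  rewrite (surjective_pairing (Phiz l (r, 0))) skewz1 /= lr /k; congr pair.
  elim: (l) => [|m IHm]; first by rewrite big_nil.
  rewrite -addn1 iotaD big_cat /= big_seq1 add0n -IHm addn1 /=.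
  by have /= -> := skewz1 m%:Z (r, 0).
exists l, k, 0 => p q p' q'; rewrite !mul0r; split=> [/PhizB eqq|[eqv _]].
  split=> //; have /dvd_l/dvdzP[c pp'] : sz (p - p') r = r.
    by rewrite -[LHS](skewz1 _ (r, q)) eqq.
  move: eqq; rewrite pp' PhizM // => -[<-].
  by rewrite -[p](subrK p') pp'; ring.
apply/PhizB.
have /dvdzP[c pp'] : (l %| p - p')%Z.
  rewrite -(@Gauss_dvdzr _ k) ?/coprimez ?gcd_lk // mulrBr.
  by apply/dvdzP; exists (q' - q); lia.
rewrite pp' PhizM //; congr pair.
have l_neq0 : l%:Z != 0 by rewrite -lt0n.
apply: (mulfI l_neq0); rewrite -[p](subrK p') pp' in eqv; lia.
Qed.


(** The orbits of s are ordered arbitrarily, and points over the same orbit by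
    their coordinates. Phi and the translations preserve this order since they
    preserve orbits and add to the coordinates amounts that only depend on the
    orbit. *)
Lemma exists_skew_order : exists lt : rel (I * int),
  [/\ strict_total lt,
      forall b b', lt (Phi b) (Phi b') = lt b b'
    & forall m i n i' n', lt (i, n + m) (i', n' + m) = lt (i, n) (i', n')].
Proof.
have [ltI [ltI_irr ltI_trans ltI_tot]] := exists_strict_total I.
have rep_ex i : exists j, `[< exists p, sz p i = j >].
  by exists i; apply/asboolP; exists 0.
(* The choice only depends on the predicate, hence is constant on orbits. *)
pose rep i := xchoose (rep_ex i).
have rep_s i : rep (s i) = rep i.
  apply: eq_xchoose => j; apply/asboolP/asboolP => -[p <-].
    by exists (p + 1); rewrite iterzD.
  by exists (p - 1); rewrite -[s i]/(sz 1 i) -iterzD // subrK.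
pose coord r (c : int * int * int) := forall p q p' q',
  Phiz p (r, q) = Phiz p' (r, q') <->
  (c.1.2 * p + c.1.1 * q = c.1.2 * p' + c.1.1 * q' /\ c.2 * p = c.2 * p').
have /choice[cf cfP] r : exists c, coord r c.
  have [l [k [u lku]]] := orbit_coord r.
  by exists (l, k, u).
have /choice[pq pqP] b : exists c : int * int, Phiz c.1 (rep b.1, c.2) = b.
  case: b => i n /=.
  have /asboolP[p pi] := xchooseP (rep_ex i); rewrite -/(rep i) in pi.
  have := skewz1 p (i, n); rewrite /= pi; case E : (Phiz p (i, n)) => [j q] /= ji.
  by exists (- p, q); rewrite /= -ji -E -PhizD addNr.
(* The coordinates v b do not depend on the presentation of b as the image
   of a point over the representative: this is vP. *)
pose v b : int * int := let c := cf (rep b.1) in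
  (c.1.2 * (pq b).1 + c.1.1 * (pq b).2, c.2 * (pq b).1).
have vP b p q : Phiz p (rep b.1, q) = b -> v b =
    ((cf (rep b.1)).1.2 * p + (cf (rep b.1)).1.1 * q, (cf (rep b.1)).2 * p).
  have := cfP (rep b.1) p q (pq b).1 (pq b).2; rewrite pqP => -[ve _] /ve[e1 e2].
  by rewrite /v e1 e2.
have v_inj b b' : rep b.1 = rep b'.1 -> v b = v b' -> b = b'.
  move=> rr [e1 e2]; rewrite -(pqP b) -(pqP b') rr.
  by apply/cfP; rewrite -rr; split; rewrite ?e1 ?e2 rr.
have v_Phi b : v (Phi b) = ((v b).1 + (cf (rep b.1)).1.2, (v b).2 + (cf (rep b.1)).2).
  rewrite (@vP _ ((pq b).1 + 1) (pq b).2) /= rep_s; last first.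
    by rewrite PhizS pqP.
  by rewrite /v /=; congr pair; ring.
have v_shift m i n : v (i, n + m) =
    ((v (i, n)).1 + (cf (rep i)).1.1 * m, (v (i, n)).2).
  rewrite (@vP _ (pq (i, n)).1 ((pq (i, n)).2 + m)) /=; last first.
    by have /= e := pqP (i, n); rewrite skewzD e.
  by rewrite /v /=; congr pair; ring.
clearbody v.
pose ltv (a b : int * int) := (a.1 < b.1) || (a.1 == b.1) && (a.2 < b.2).
exists (fun b b' => ltI (rep b.1) (rep b'.1) ||
                    (rep b.1 == rep b'.1) && ltv (v b) (v b')); split.
- split.
  + by move=> b; rewrite /= ltI_irr eqxx /ltv !ltxx eqxx.
  + move=> b b' b'' /orP[lt1|/andP[/eqP e1 lt1]] /orP[lt2|/andP[/eqP e2 lt2]].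
    * by rewrite (ltI_trans _ _ _ lt1 lt2).
    * by rewrite -e2 lt1.
    * by rewrite e1 lt2.
    * rewrite e1 e2 eqxx; apply/orP; right => /=; move: lt1 lt2; rewrite /ltv.
      by lia.
  + move=> b b' bb'; case: (eqVneq (rep b.1) (rep b'.1)) => [e|/ltI_tot]; last first.
      by case/orP=> ->; rewrite ?orbT.
    have : v b != v b' by apply: contra bb' => /eqP/(v_inj _ _ e) ->.
    rewrite e ltI_irr /ltv; case: (v b) (v b') => [v1 v2] [v1' v2'] /=.
    by rewrite xpair_eqE; lia.
- move=> b b'; rewrite /= !rep_s !v_Phi; case: eqVneq => //= ->.
  by rewrite /ltv /= !ltrD2r (inj_eq (addIr _)).
- move=> m i n i' n'; rewrite /= !v_shift; case: eqVneq => //= ->.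
  by rewrite /ltv /= !ltrD2r (inj_eq (addIr _)).
Qed.

End SkewOrder.

(** * Left multiplication by 1 + b on noncommutative power series *)

(** Series are functions on words. The power series ring itself is avoided:
    b acts by the permutation f |-> (1 + b) f of the set of series, so that a
    group of permutations receives the free group, and the product conv is
    only needed to express coefficients of products. *)
Section Series.
Context (B : eqType).
Implicit Types (b : B) (w u v : seq B) (f c : seq B -> int).

Definition delta w : int := (w == [::])%:R.

Definition lmul b f w : int :=
  f w + (if w is a :: w' then (if a == b then f w' else 0) else 0).

Fixpoint lmulV b f w : int :=
  f w - (if w is a :: w' then (if a == b then lmulV b f w' else 0) else 0).

Definition conv c f w : int :=
  \sum_(i < (size w).+1) c (take i w) * f (drop i w).

Lemma lmulK b : cancel (lmul b) (lmulV b).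
Proof.
move=> f; apply/funext; elim=> [|a w IHw] /=; first by rewrite /lmul addr0 subr0.
by rewrite IHw /lmul addrK.
Qed.

Lemma lmulVK b : cancel (lmulV b) (lmul b).
Proof. by move=> f; apply/funext=> -[|a w] /=; rewrite /lmul /= subrK. Qed.

Lemma conv_nil c f : conv c f [::] = c [::] * f [::].
Proof. by rewrite /conv big_ord1. Qed.

Lemma conv_cons c f a w :
  conv c f (a :: w) = c [::] * f (a :: w) + conv (fun u => c (a :: u)) f w.
Proof. by rewrite /conv big_ord_recl. Qed.

Lemma convDl c c' f w :
  conv (fun u => c u + c' u) f w = conv c f w + conv c' f w.
Proof. by rewrite -big_split; apply: eq_bigr => i _; rewrite mulrDl. Qed.

Lemma conv0 f w : conv (fun=> 0) f w = 0.
Proof. by rewrite /conv big1 // => i _; rewrite mul0r. Qed.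

Lemma conv_delta f : conv delta f = f.
Proof.
apply/funext => -[|a w]; first by rewrite conv_nil mul1r.
by rewrite conv_cons mul1r (conv0 f w) addr0.
Qed.

(** Associativity of the product of series, for a left factor 1 + b. *)
Lemma lmul_conv b c f : lmul b (conv c f) = conv (lmul b c) f.
Proof.
apply/funext => w; rewrite convDl; congr +%R; case: w => [|a w].
  by rewrite conv_nil mul0r.
by rewrite conv_cons mul0r add0r; case: (a == b); rewrite ?conv0.
Qed.

Definition lmulP b : permt (seq B -> int) := Permt (lmulK b) (lmulVK b).

End Series.

(** * The length-lexicographic order on words *)

Section WordOrder.
Context (B : eqType) (lt : rel B).
Hypothesis lt_st : strict_total lt.
Implicit Types u v w : seq B.

Fixpoint lex_lt u v : bool :=
  match u, v with
  | a :: u', b :: v' => lt a b || (a == b) && lex_lt u' v'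
  | _, _ => false
  end.

Definition word_lt u v : bool :=
  (size u < size v)%N || (size u == size v) && lex_lt u v.

Lemma word_lt_size u v : word_lt u v -> (size u <= size v)%N.
Proof. by case/orP=> [/ltnW //|/andP[/eqP -> _]]. Qed.

Lemma word_lt_strict_total : strict_total word_lt.
Proof.
have [lt_irr lt_trans lt_tot] := lt_st; split.
- move=> w; rewrite /word_lt ltnn eqxx /=.
  by elim: w => //= a w ->; rewrite lt_irr andbF.
- have lex_trans : transitive lex_lt.
    move=> v u; elim: u v => [|a u IHu] [|b v] //= [|d w] //.
    case/orP=> [ab|/andP[/eqP -> uv]] /orP[bd|/andP[/eqP <- vw]].
    + by rewrite (lt_trans _ _ _ ab bd).
    + by rewrite ab.
    + by rewrite bd.
    + by rewrite eqxx (IHu _ _ uv vw) orbT.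
  move=> v u w; rewrite /word_lt.
  case/orP=> [uv|/andP[/eqP -> uv]] /orP[vw|/andP[/eqP <- vw]].
  + by rewrite (ltn_trans uv vw).
  + by rewrite uv.
  + by rewrite vw.
  + by rewrite eqxx (lex_trans _ _ _ uv vw) orbT.
move=> u v uv; rewrite /word_lt; case: ltngtP => //= uv_size.
elim: u v uv uv_size => [|a u IHu] [|b v] //=; rewrite eqseq_cons.
have [->|ab _ _] := eqVneq a b; last by case/orP: (lt_tot _ _ ab) => ->; rewrite ?orbT.
by rewrite lt_irr => uv [uv_size]; apply: IHu.
Qed.

Lemma word_lt_map (Psi : B -> B) : injective Psi ->
  (forall a b, lt (Psi a) (Psi b) = lt a b) ->
  forall u v, word_lt (map Psi u) (map Psi v) = word_lt u v.
Proof.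
move=> Psi_inj Psi_lt u v; rewrite /word_lt !size_map; congr (_ || (_ && _)).
elim: u v => [|a u IHu] [|b v] //=.
by rewrite Psi_lt IHu (inj_eq Psi_inj).
Qed.

End WordOrder.

Lemma seq_min (T : eqType) (lt : rel T) (P : pred T) (s : seq T) x :
  strict_total lt -> x \in s -> P x ->
  exists2 m, P m & forall z, z \in s -> P z -> ~~ lt z m.
Proof.
move=> [lt_irr lt_trans lt_tot]; elim: s x => [//|a s IHs] x xs Px.
have [/hasP[x' x's Px'] | no_s] := boolP (has P s); last first.
  have Ps z : z \in s -> ~~ P z by move/hasPn: no_s; apply.
  exists a; first by move: xs; rewrite inE => /predU1P[<- //|/Ps]; rewrite Px.
  by move=> z; rewrite inE => /predU1P[->|/Ps/negPf ->]; rewrite ?lt_irr.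
have [m Pm m_min] := IHs x' x's Px'.
have [/andP[Pa am] | nam] := boolP (P a && lt a m).
  exists a => // z; rewrite inE => /predU1P[->|zs] Pz; first by rewrite lt_irr.
  by apply: contra (m_min z zs Pz) => za; apply: lt_trans am.
exists m => // z; rewrite inE => /predU1P[-> Pa|]; last exact: m_min.
by move: nam; rewrite Pa.
Qed.

(** * Magnus coefficients *)

(** The hypothesis ker_ind says that the elements y b generate the kernel of h,
    and c k w is the coefficient of the word w in the expansion of k that sends
    y b to 1 + b. *)
Section Magnus.
Context (F : groupType) (h : F -> int) (B : eqType) (y : B -> F).
Hypothesis hM : forall u v : F, h (u * v)%g = h u + h v.
Hypothesis h_y : forall b, h (y b) = 0.
Hypothesis ker_ind : forall P : F -> Prop, P 1%g ->
  (forall b k, h k = 0 -> P k -> P (y b * k)%g) ->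
  (forall b k, h k = 0 -> P (y b * k)%g -> P k) ->
  forall k, h k = 0 -> P k.
Context (c : F -> seq B -> int).
Hypothesis c1 : c 1%g = @delta B.
Hypothesis c_y : forall b k, c (y b * k)%g = lmul b (c k).

Lemma h1 : h 1%g = 0.
Proof. by apply: (addrI (h 1%g)); rewrite -hM mulg1 addr0. Qed.

Lemma hV g : h g^-1%g = - h g.
Proof. by apply: (addrI (h g)); rewrite -hM mulgV h1 subrr. Qed.

Lemma h_ker b k : h k = 0 -> h (y b * k)%g = 0.
Proof. by move=> hk; rewrite hM h_y hk. Qed.

Lemma coefM k k' : h k = 0 -> c (k * k')%g = conv (c k) (c k').
Proof.
move: k; apply: ker_ind => [|b k _ IHk|b k _ IHk].
- by rewrite mul1g c1 conv_delta.
- by rewrite -mulgA !c_y IHk lmul_conv.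
by apply: (can_inj (lmulK b)); rewrite -c_y mulgA IHk c_y lmul_conv.
Qed.

Lemma coef_nil k : h k = 0 -> c k [::] = 1.
Proof.
move: k; apply: ker_ind => [|b k _ IHk|b k _ <-]; first by rewrite c1.
  by rewrite c_y /lmul addr0.
by rewrite c_y /lmul addr0.
Qed.

Lemma coef1M k k' a : h k = 0 -> h k' = 0 ->
  c (k * k')%g [:: a] = c k [:: a] + c k' [:: a].
Proof.
move=> hk hk'; rewrite coefM // conv_cons conv_nil !coef_nil //.
by rewrite mul1r mulr1 addrC.
Qed.

Lemma coef1J k g a : h k = 0 -> h g = 0 ->
  c (k * g * k^-1)%g [:: a] = c g [:: a].
Proof.
move=> hk hg; have hkV : h k^-1%g = 0 by rewrite hV hk.
have hkg : h (k * g)%g = 0 by rewrite hM hk hg.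
have := coef1M a hk hkV; rewrite mulgV c1 /delta /= => e.
by rewrite !coef1M // addrAC -e add0r.
Qed.

Lemma coef1_y b a : c (y b) [:: a] = (a == b)%:R.
Proof. by rewrite -[y b]mulg1 c_y c1 /lmul /delta /= add0r; case: eqP. Qed.

(** ** Injectivity of the Magnus expansion *)

(** The expansion of y b to the power e is 1 + e b plus terms in powers of b,
    and these do not contribute if the word ends its run of b at once. *)
Lemma coef_block b e k w : ohead w != Some b ->
  c (zpow (y b) e * k)%g w = c k w /\
  c (zpow (y b) e * k)%g (b :: w) = c k (b :: w) + e * c k w.
Proof.
move=> wb.
have step k' : c (y b * k')%g w = c k' w.
  by rewrite c_y /lmul; case: w wb => [|a w'] /= wb; rewrite ?addr0 // ifN ?addr0.
have step' k' : c (y b * k')%g (b :: w) = c k' (b :: w) + c k' w.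
  by rewrite c_y /lmul eqxx.
elim/int_shift_ind: e => [|e [IH1 IH2]|e].
- by rewrite zpow0 mul1g mul0r addr0.
- by rewrite zpowS -mulgA step step' IH1 IH2; split=> //; ring.
rewrite zpowS -mulgA step step' => -[-> IH2]; split=> //.
by apply: (addIr (c k w)); rewrite IH2; ring.
Qed.

Definition block_eval (s : seq (B * int)) : F :=
  foldr (fun p g => zpow (y p.1) p.2 * g)%g 1%g s.

Definition reduced (s : seq (B * int)) : bool :=
  all (fun p => p.2 != 0) s && sorted (fun a b => a != b) (map fst s).

Lemma reduced_cons p s : reduced (p :: s) =
  [&& p.2 != 0, ohead (map fst s) != Some p.1 & reduced s].
Proof.
rewrite /reduced /=; case: s => [|q s] /=; first by rewrite andbT.
rewrite (inj_eq Some_inj) [q.1 == _]eq_sym.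
by case: (p.2 == 0); case: (p.1 == q.1); rewrite /= ?andbF.
Qed.

Lemma reduced_block b e s : reduced s -> exists2 s', reduced s' &
  block_eval s' = (zpow (y b) e * block_eval s)%g.
Proof.
move=> red_s; have [-> | e_neq0] := eqVneq e 0.
  by exists s; rewrite ?zpow0 ?mul1g.
have [/eqP sb | sb] := boolP (ohead (map fst s) == Some b); last first.
  by exists ((b, e) :: s); rewrite ?reduced_cons /= ?e_neq0 ?sb.
case: s red_s sb => [|[b' e'] s] //=; rewrite reduced_cons /=.
move=> /and3P[e'_neq0 sb' red_s] [eb]; rewrite {b'}eb in sb' *.
rewrite mulgA -zpowD; have [-> | ee_neq0] := eqVneq (e + e') 0.
  by exists s; rewrite // zpow0 mul1g.
by exists ((b, e + e') :: s); rewrite ?reduced_cons /= ?ee_neq0 ?sb'.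
Qed.

Lemma reduced_form k : h k = 0 -> exists2 s, reduced s & block_eval s = k.
Proof.
move: k; apply: ker_ind; first by exists [::].
  move=> b k _ [s /(reduced_block b 1)[s' red_s' s'E] <-].
  by exists s' => //; rewrite s'E zpow1.
move=> b k _ [s /(reduced_block b (-1))[s' red_s' s'E] sE].
by exists s' => //; rewrite s'E sE zpowN zpow1 mulKg.
Qed.

(** A block contributes at most one letter to a word without equal neighbours, so
    such a word has coefficient zero if it is longer than the list of blocks. *)
Lemma coef_long s w : sorted (fun a b : B => a != b) w -> (size s < size w)%N ->
  c (block_eval s) w = 0.
Proof.
elim: s w => [|[b e] s IHs] [|a w] //= alt_w sw; first by rewrite c1.
have [ab | nab] := eqVneq a b; last first.
  have wb : ohead (a :: w) != Some b by rewrite /= (inj_eq Some_inj).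
  by have [-> _] := coef_block e (block_eval s) wb; apply: IHs => //; apply: ltnW.
subst a; have wb : ohead w != Some b.
  by case: w alt_w {sw} => //= a w /andP[ab _]; rewrite (inj_eq Some_inj) eq_sym.
have [_ ->] := coef_block e (block_eval s) wb.
rewrite !IHs ?mulr0 ?addr0 //; first exact: (path_sorted alt_w).
exact: ltnW.
Qed.

(** The coefficient is the product of the exponents: each block has to
    contribute its letter, by coef_long. *)
Lemma coef_top s : reduced s -> c (block_eval s) (map fst s) != 0.
Proof.
elim: s => [|[b e] s IHs]; first by rewrite c1.
move=> red_s; have := red_s; rewrite reduced_cons /= => /and3P[e_neq0 sb red_s'].
have [_ ->] := coef_block e (block_eval s) sb.
rewrite (@coef_long s) /= ?size_map //; last by case/andP: red_s.
by rewrite add0r mulf_neq0 ?IHs.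
Qed.

Lemma magnus_faithful k : h k = 0 -> k != 1%g ->
  exists2 w, w != [::] & c k w != 0.
Proof.
move=> /reduced_form[s red_s <-] s_neq1; exists (map fst s); last exact: coef_top.
by apply: contra s_neq1; rewrite -!size_eq0 size_map => /nilP ->.
Qed.

(** ** Differences of functions on the kernel, and their Taylor formula *)

(** Iterated left differences with respect to the generators y b; their first
    letter is the first difference taken. *)
Fixpoint difs (w : seq B) (f : F -> int) : F -> int :=
  if w is b :: w' then difs w' (fun k => f (y b * k)%g - f k) else f.

(** Polynomial functions on the kernel, of degree less than n. *)
Definition deg_lt (n : nat) (f : F -> int) : Prop :=
  forall w k, (n <= size w)%N -> h k = 0 -> difs w f k = 0.

Lemma eq_difs w f g : (forall k, h k = 0 -> f k = g k) ->
  forall k, h k = 0 -> difs w f k = difs w g k.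
Proof.
elim: w f g => [//|b w IHw] f g fg /=; apply: IHw => k hk.
by rewrite !fg // h_ker.
Qed.

Lemma difs_sum w n (a : 'I_n -> int) (f : 'I_n -> F -> int) k :
  difs w (fun k => \sum_(i < n) a i * f i k) k = \sum_(i < n) a i * difs w (f i) k.
Proof.
elim: w f => [//|b w IHw] f /=; rewrite -IHw; congr (difs w _ k).
by apply/funext => k'; rewrite -sumrB; apply: eq_bigr => i _; rewrite mulrBr.
Qed.

Lemma difsB w f g k : difs w (fun k => f k - g k) k = difs w f k - difs w g k.
Proof.
elim: w f g => [//|b w IHw] f g /=; rewrite -IHw; congr (difs w _ k).
by apply/funext => k'; ring.
Qed.

Lemma difs0 w k : difs w (fun=> 0) k = 0.
Proof. by elim: w => //= b w <-; rewrite subrr. Qed.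

(** The list p of coefficients and words depends on k but not on f. It is
    built along a word for k by f (y b k) = f k + (difference of f along b) k.
    To pass from y b k back to k the difference is evaluated at k itself,
    where its smaller degree makes it known. *)
Lemma taylor n k : h k = 0 -> exists p : seq (int * seq B),
  forall f, deg_lt n f -> f k = \sum_(q <- p) q.1 * difs q.2 f 1%g.
Proof.
elim: n k => [|n IHn] k hk.
  by exists [::] => f f0; rewrite big_nil; apply: (f0 [::]).
have dif_deg b f : deg_lt n.+1 f -> deg_lt n (fun k => f (y b * k)%g - f k).
  by move=> f_deg w k' nw; apply: (f_deg (b :: w)).
have deg_up f : deg_lt n f -> deg_lt n.+1 f.
  by move=> f_deg w k' nw; apply: f_deg; apply: ltnW.
move: k hk; apply: ker_ind => [|b k hk [p pP]|b k hk [p pP]].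
- by exists [:: (1, [::])] => f _; rewrite big_seq1 mul1r.
- exists (p ++ [seq (q.1, b :: q.2) | q <- p]) => f f_deg.
  rewrite big_cat big_map /= -pP // -(pP (fun k => f (y b * k)%g - f k)).
    by rewrite addrC subrK.
  exact/deg_up/dif_deg.
have [p' p'P] := IHn k hk.
exists (p ++ [seq (- q.1, b :: q.2) | q <- p']) => f f_deg.
rewrite big_cat big_map /= -pP //.
under eq_bigr do rewrite mulNr.
rewrite sumrN -(p'P (fun k => f (y b * k)%g - f k)); last exact: dif_deg.
by rewrite opprB addrC subrK.
Qed.

Lemma difs_coef1 u w : difs u (fun k => c k w) 1%g = (u == w)%:R.
Proof.
elim: u w => [|b u IHu] w /=; first by rewrite c1 /delta eq_sym.
under eq_fun do rewrite c_y /lmul addrAC subrr add0r.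
case: w => [|a w]; first exact: difs0.
rewrite eqseq_cons [b == a]eq_sym; case: (a == b); first exact: IHu.
exact: difs0.
Qed.

Section Equivariance.
Context (psi : F -> F) (Psi : B -> B).
Hypothesis psiM : {morph psi : u v / (u * v)%g}.
Hypothesis h_psi : forall k, h k = 0 -> h (psi k) = 0.
Hypothesis psi_y : forall b a, c (psi (y b)) [:: a] = (a == Psi b)%:R.

(** The coefficient of w in psi k is a polynomial function of k of degree at
    most size w: multiplying k by y b adds products of a coefficient of
    psi (y b) and a coefficient of psi k at a proper suffix of w. Only the
    longest suffix matters for the differences of top order, and its factor
    is a coefficient of degree one of psi (y b). *)
Lemma difs_coef_top u w k : (size w <= size u)%N -> h k = 0 ->
  difs u (fun k => c (psi k) w) k = (w == map Psi u)%:R.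
Proof.
move=> + hk; elim: u w => [|b u IHu] w /=.
  by case: w => // _; rewrite coef_nil ?h_psi.
move=> wu.
have -> : difs u (fun k => c (psi (y b * k)%g) w - c (psi k) w) k =
    difs u (fun k => \sum_(i < size w) c (psi (y b)) (take i.+1 w) *
                     c (psi k) (drop i.+1 w)) k.
  apply: eq_difs hk => k' hk'.
  rewrite psiM coefM ?h_psi // /conv big_ord_recl take0 drop0.
  by rewrite coef_nil ?h_psi // mul1r addrAC subrr add0r.
rewrite difs_sum; case: w wu => [|a w] wu; first by rewrite big_ord0.
rewrite big_ord_recl /= take0 drop0 psi_y IHu // eqseq_cons.
rewrite big1 ?addr0; last first.
  move=> i _; have iw : (i < size w)%N := ltn_ord i.
  have wu' : (size w <= size u)%N := wu.
  rewrite IHu ?size_drop /bump /=; last by lia.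
  case: eqP => [/(congr1 size)|]; last by rewrite mulr0.
  by rewrite size_drop size_map; lia.
by case: (a == _); rewrite ?mul1r ?mul0r.
Qed.

End Equivariance.

Lemma difs_coef u w k : (size w <= size u)%N -> h k = 0 ->
  difs u (fun k => c k w) k = (w == u)%:R.
Proof.
move=> wu hk; rewrite -[u in RHS]map_id.
exact: (@difs_coef_top id id (fun _ _ => erefl) (fun _ => id) coef1_y).
Qed.

Lemma coef_deg n w : (size w < n)%N -> deg_lt n (fun k => c k w).
Proof.
move=> wn u k nu hk; rewrite difs_coef ?(leq_trans (ltnW wn) nu) //.
by case: eqP => // wu; move: wn; rewrite wu ltnNge nu.
Qed.

Lemma taylor_coef n k : h k = 0 -> exists2 p : seq (int * seq B),
  forall f, deg_lt n f -> f k = \sum_(q <- p) q.1 * difs q.2 f 1%g &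
  forall w, (size w < n)%N -> c k w = \sum_(q <- p) q.1 * (q.2 == w)%:R.
Proof.
move=> hk; have [p pP] := taylor n hk; exists p => // w wn.
rewrite (pP _ (coef_deg wn)); apply: eq_bigr => q _.
by rewrite difs_coef1.
Qed.

(** By the Taylor formula the coefficient of w in k is the sum of the entries
    of a finite list that are attached to w. *)
Lemma coef_support n k : h k = 0 -> exists S : seq (seq B),
  forall w, (size w < n)%N -> c k w != 0 -> w \in S.
Proof.
move=> hk; have [p _ pP] := taylor_coef n hk; exists (map snd p) => w wn.
rewrite pP //; apply: contraR => wp; rewrite big1_seq // => q /andP[_ qp].
case: eqP => [qw|]; last by rewrite mulr0.
by rewrite -qw map_f in wp.
Qed.

(** Gathering the terms of the Taylor formula by words, the word w occurs in
    it with the factor c k w, and only the empty word is left. *)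
Lemma deg_lt_const n f k : deg_lt n f -> h k = 0 ->
  (forall w, (0 < size w < n)%N -> c k w = 0) -> f k = f 1%g.
Proof.
move=> f_deg hk ck0; have [n0|n_gt0] := posnP n.
  have f0 j : h j = 0 -> f j = 0 by apply: (f_deg [::]); rewrite n0.
  by rewrite !f0 ?h1.
have [p -> // pP] := taylor_coef n hk.
pose S := undup ([::] :: map snd p).
have -> : \sum_(q <- p) q.1 * difs q.2 f 1%g =
    \sum_(w <- S) difs w f 1%g * \sum_(q <- p) q.1 * (q.2 == w)%:R.
  under [RHS]eq_bigr do rewrite mulr_sumr.
  rewrite exchange_big /=; apply: eq_big_seq => q qp.
  rewrite (bigD1_seq q.2) ?undup_uniq //=; last first.
    by rewrite mem_undup inE map_f ?orbT.
  rewrite eqxx mulr1 mulrC big1 ?addr0 // => w wq.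
  by rewrite eq_sym (negPf wq) !mulr0.
rewrite (bigD1_seq [::]) ?undup_uniq ?mem_undup ?mem_head //=.
rewrite -pP // coef_nil // mulr1 big1 ?addr0 // => w w_neq0.
have [nw|wn] := leqP n (size w); first by rewrite f_deg ?h1 ?mul0r.
by rewrite -pP // ck0 ?mulr0 // wn lt0n size_eq0 w_neq0.
Qed.

(** The difference of the two sides, as a function of k, has degree less than
    size u since the differences of top order agree, so it is constant. *)
Lemma coef_equivariant (psi : F -> F) (Psi : B -> B) :
  {morph psi : u v / (u * v)%g} -> (forall k, h k = 0 -> h (psi k) = 0) ->
  injective Psi -> (forall b a, c (psi (y b)) [:: a] = (a == Psi b)%:R) ->
  forall k u, h k = 0 -> (forall w, (0 < size w < size u)%N -> c k w = 0) ->
  c (psi k) (map Psi u) = c k u.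
Proof.
move=> psiM h_psi Psi_inj psi_y k u hk ck0.
have psi1 : psi 1%g = 1%g by apply: (mulgI (psi 1%g)); rewrite -psiM !mulg1.
pose f k := c (psi k) (map Psi u) - c k u.
have f_deg : deg_lt (size u) f.
  move=> w k' uw hk'; rewrite difsB (difs_coef_top psiM h_psi psi_y) ?size_map //.
  by rewrite difs_coef // (inj_eq (inj_map Psi_inj)) subrr.
have := deg_lt_const f_deg hk ck0; rewrite /f psi1 c1 /delta.
by case: (u) => [|b w] /= /eqP; rewrite subrr subr_eq0 => /eqP.
Qed.

(** ** The order defined by leading Magnus coefficients *)

Lemma coefD k k' u : h k = 0 -> h k' = 0 -> u != [::] ->
  (forall w, (0 < size w < size u)%N -> c k w = 0) ->
  c (k * k')%g u = c k u + c k' u.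
Proof.
case: u => // a u hk hk' _ ck0; rewrite coefM //.
rewrite /conv big_ord_recl big_ord_recr /= take_size drop_size !coef_nil //.
rewrite mul1r mulr1 big1 ?add0r; first by rewrite addrC.
move=> i _; have iu : (i < size u)%N := ltn_ord i.
by rewrite ck0 ?mul0r //= size_take iu.
Qed.

Context (lt : rel B).
Hypothesis lt_st : strict_total lt.
Local Notation wlt := (word_lt lt).

(** The word w itself need not occur in the expansion of k: two elements can
    then be compared at the smaller of their first words. *)
Definition leads w k : Prop :=
  w != [::] /\ forall v, v != [::] -> wlt v w -> c k v = 0.

Definition pos_ker k : Prop := exists2 w, leads w k & 0 < c k w.

Lemma leads_low w k v : leads w k -> v = w \/ wlt v w ->
  forall u, (0 < size u < size v)%N -> c k u = 0.
Proof.
move=> [_ ck0] vw u /andP[u_gt0 uv]; apply: ck0; first by rewrite -size_eq0 -lt0n.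
have vw_size : (size v <= size w)%N by case: vw => [->|/word_lt_size].
by rewrite /word_lt (leq_trans uv vw_size).
Qed.

(** By finiteness of the support in bounded degree, a first word exists. *)
Lemma exists_lead k : h k = 0 -> k != 1%g -> exists2 w, leads w k & c k w != 0.
Proof.
move=> hk k_neq1; have wst := word_lt_strict_total lt_st.
have [w0 w0_neq0 cw0] := magnus_faithful hk k_neq1.
have [S SP] := coef_support (size w0).+1 hk.
have w0S : w0 \in S by apply: SP.
pose P v := (v != [::]) && (c k v != 0).
have [|w /andP[w_neq0 cw] w_min] := @seq_min _ _ P S w0 wst w0S.
  by rewrite /P w0_neq0.
exists w => //; split=> // v v_neq0 vw; apply: contrapT => /eqP cv.
suff /w_min : v \in S by rewrite /P v_neq0 cv vw => /(_ isT).
apply: SP => //; rewrite ltnS; apply: leq_trans (word_lt_size vw) _.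
have := w_min w0 w0S; rewrite /P w0_neq0 cw0 => /(_ isT).
by rewrite /word_lt negb_or -leqNgt => /andP[].
Qed.

Lemma leads_trans v w k : leads w k -> wlt v w -> v != [::] -> leads v k.
Proof.
have [_ wlt_trans _] := word_lt_strict_total lt_st.
move=> [_ ck0] vw v_neq0; split=> // u u_neq0 uv.
by apply: ck0 => //; apply: wlt_trans vw.
Qed.

Lemma leadsM w k k' : h k = 0 -> h k' = 0 -> leads w k -> leads w k' ->
  leads w (k * k')%g /\ c (k * k')%g w = c k w + c k' w.
Proof.
move=> hk hk' lk lk'; have [w_neq0 ck0] := lk; have [_ ck0'] := lk'; split.
  split=> // v v_neq0 vw.
  by rewrite coefD ?ck0 ?ck0' // => u; apply: (leads_low lk); right.
by rewrite coefD // => u; apply: (leads_low lk); left.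
Qed.

Lemma leadsV w k : h k = 0 -> leads w k ->
  leads w k^-1%g /\ c k^-1%g w = - c k w.
Proof.
move=> hk lk; have [w_neq0 ck0] := lk.
have hkV : h k^-1%g = 0 by rewrite hV hk oppr0.
have inv v : v != [::] -> v = w \/ wlt v w -> c k^-1%g v = - c k v.
  move=> v_neq0 vw; apply/eqP; rewrite -addr_eq0 addrC.
  rewrite -coefD // ?mulgV ?c1 /delta ?(negPf v_neq0) //.
  exact: (leads_low lk).
split; last by apply: inv => //; left.
by split=> // v v_neq0 vw; rewrite inv ?ck0 ?oppr0 //; right.
Qed.

Lemma pos_kerM k k' : h k = 0 -> h k' = 0 ->
  pos_ker k -> pos_ker k' -> pos_ker (k * k')%g.
Proof.
move=> hk hk' [w lk pk] [w' lk' pk'].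
have [w_neq0 ck0] := lk; have [w'_neq0 ck0'] := lk'.
have [wlt_irr _ wlt_tot] := word_lt_strict_total lt_st.
have [ww'|] := eqVneq w w'.
  rewrite -ww' in lk' pk'; have [lkk' ckk'] := leadsM hk hk' lk lk'.
  by exists w => //; rewrite ckk' addr_gt0.
case/wlt_tot/orP=> ww'.
  have [lkk' ckk'] := leadsM hk hk' lk (leads_trans lk' ww' w_neq0).
  by exists w => //; rewrite ckk' (ck0' w) // addr0.
have [lkk' ckk'] := leadsM hk hk' (leads_trans lk ww' w'_neq0) lk'.
by exists w' => //; rewrite ckk' (ck0 w') // add0r.
Qed.

Lemma pos_ker_total k : h k = 0 -> k != 1%g -> pos_ker k \/ pos_ker k^-1%g.
Proof.
move=> hk /(exists_lead hk)[w lk ckw]; have [lkV ckV] := leadsV hk lk.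
case: (ltgtP 0 (c k w)) ckw => // ckw _; first by left; exists w.
by right; exists w; rewrite // ckV oppr_gt0.
Qed.

Lemma pos_ker1 : ~ pos_ker 1%g.
Proof. by case=> w [w_neq0 _]; rewrite c1 /delta (negPf w_neq0) ltxx. Qed.

(** The endomorphisms, such as phi and the inner automorphisms, that act on
    the abelianization of the kernel by an order automorphism of its basis. *)
Definition order_shift (psi : F -> F) : Prop :=
  [/\ {morph psi : u v / (u * v)%g}, forall g, h (psi g) = h g &
    exists Psi PsiV : B -> B, [/\ cancel Psi PsiV, cancel PsiV Psi,
      forall a b, lt (Psi a) (Psi b) = lt a b &
      forall b a, c (psi (y b)) [:: a] = (a == Psi b)%:R]].

(** The first word w of k is replaced by Psi w, with the same coefficient,
    because Psi respects the order of words. *)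
Lemma pos_ker_shift psi k : order_shift psi -> h k = 0 ->
  pos_ker k -> pos_ker (psi k).
Proof.
move=> [psiM h_psi [Psi [PsiV [PsiK PsiVK Psi_lt psi_y]]]] hk [w lk pk].
have h_psi0 j : h j = 0 -> h (psi j) = 0 by rewrite h_psi.
have equi := coef_equivariant psiM h_psi0 (can_inj PsiK) psi_y hk.
have [w_neq0 ck0] := lk; exists (map Psi w); last first.
  by rewrite equi // => u; apply: (leads_low lk); left.
split=> [|v v_neq0]; first by case: (w) w_neq0.
have {v v_neq0} [v v_neq0 ->] : exists2 v', v' != [::] & v = map Psi v'.
  exists (map PsiV v); first by case: (v) v_neq0.
  by rewrite -map_comp map_id_in // => a _; apply: PsiVK.
rewrite (word_lt_map (can_inj PsiK) Psi_lt) => vw.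
by rewrite equi ?ck0 // => u; apply: (leads_low lk); right.
Qed.

Definition pos g : Prop := 0 < h g \/ h g = 0 /\ pos_ker g.

Lemma posM g g' : pos g -> pos g' -> pos (g * g')%g.
Proof.
rewrite /pos hM => -[hg|[hg pg]] [hg'|[hg' pg']].
- by left; rewrite addr_gt0.
- by left; rewrite hg' addr0.
- by left; rewrite hg add0r.
- by right; rewrite hg hg' addr0; split=> //; apply: pos_kerM.
Qed.

Lemma pos1 : ~ pos 1%g.
Proof. by rewrite /pos h1 ltxx => -[//|[_ /pos_ker1]]. Qed.

Lemma pos_total g : g != 1%g -> pos g \/ pos g^-1%g.
Proof.
move=> g_neq1; rewrite /pos hV oppr_gt0.
case: (ltgtP 0 (h g)) => hg; [by left; left | by right; left |].
rewrite -hg oppr0; have [pg|pg] := pos_ker_total (esym hg) g_neq1.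
  by left; right.
by right; right.
Qed.

Lemma pos_shift psi g : order_shift psi -> pos g -> pos (psi g).
Proof.
move=> sh; have [_ h_psi _] := sh; rewrite /pos h_psi.
by move=> [|[hg pg]]; [left | right; split=> //; apply: pos_ker_shift].
Qed.

(** f < g if f^-1 g is positive. Invariance on the right is invariance of
    positivity under conjugation; for psi, one implication is pos_shift and
    totality gives the other. *)
Lemma magnus_bi_ordering :
  (forall g, order_shift (fun k => g * k * g^-1)%g) ->
  exists ltF : rel F, bi_ordering ltF /\
    forall psi : {multiplicative F -> F}, order_shift psi -> invariant_under psi ltF.
Proof.
move=> conj_shift; exists (fun f g => `[< pos (f^-1 * g)%g >]); split.
  split.
  - by move=> f; apply/asboolP; rewrite mulVg; apply: pos1.
  - move=> g f k /asboolP fg /asboolP gk; apply/asboolP.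
    by have := posM fg gk; rewrite mulgA mulgK.
  - move=> f g fg; have : (f^-1 * g)%g != 1%g.
      by apply: contra fg => /eqP/mulg1_eq; rewrite invgK => ->.
    case/pos_total => p; apply/orP; [left | right]; apply/asboolP => //.
    by move: p; rewrite invgM invgK.
  - move=> f g k /asboolP fg; apply/asboolP.
    by rewrite invgM -mulgA mulKg.
  - move=> f g k /asboolP fg; apply/asboolP.
    have := pos_shift (conj_shift k^-1%g) fg.
    by rewrite invgK invgM !mulgA.
move=> psi sh f g; have psiV := morph_inv psi.
split=> /asboolP fg; apply/asboolP.
  by have := pos_shift sh fg; rewrite gmulfM psiV.
rewrite -psiV -gmulfM in fg.
have [e|/pos_total[//|p]] := eqVneq (f^-1 * g)%g 1%g.
  by move: fg; rewrite e morph_one => /pos1.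
by have := posM fg (pos_shift sh p); rewrite -gmulfM mulgV morph_one => /pos1.
Qed.

End Magnus.

(** * The kernel of h and its Magnus expansion *)

Section Kernel.
Context (I : choiceType) (F : groupType) (x : I -> F).
Hypothesis x_free : freely_generates x.
Context (i0 : I) (h : F -> int).
Hypothesis hM : forall u v : F, h (u * v)%g = h u + h v.
Hypothesis h_i0 : h (x i0) = 1.
Hypothesis h_j : forall j, j != i0 -> h (x j) = 0.

Local Notation J := {i : I | i != i0}.
Local Notation B := (J * int)%type.
Local Notation t := (x i0).

Definition ker_gen (b : B) : F :=
  (zpow t b.2 * x (val b.1) * (zpow t b.2)^-1)%g.
Local Notation y := ker_gen.

Definition translate (m : int) (b : B) : B := (b.1, b.2 + m).

Lemma translateK m : cancel (translate m) (translate (- m)).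
Proof. by case=> j n; rewrite /translate /= addrK. Qed.

Lemma translateNK m : cancel (translate (- m)) (translate m).
Proof. by case=> j n; rewrite /translate /= subrK. Qed.

Lemma h_zpow g m : h (zpow g m) = m * h g.
Proof.
elim/int_shift_ind: m => [|m IHm|m].
- by rewrite zpow0 (h1 hM) mul0r.
- by rewrite zpowS hM IHm; ring.
by rewrite zpowS hM => e; apply: (addrI (h g)); rewrite e; ring.
Qed.

Lemma h_conj g k : h (g * k * g^-1)%g = h k.
Proof. by rewrite !hM (hV hM) addrAC subrr add0r. Qed.

Lemma h_ker_gen b : h (y b) = 0.
Proof. by rewrite h_conj h_j // (valP b.1). Qed.

Lemma ker_gen0 j : y (j, 0) = x (val j).
Proof. by rewrite /y /= mul1g invg1 mulg1. Qed.

Lemma ker_gen_translate m b :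
  (zpow t m * y b * (zpow t m)^-1)%g = y (translate m b).
Proof. by rewrite /y /translate /= addrC zpowD invgM !mulgA. Qed.

(** The elements N of the kernel by which every predicate stable under the
    generators is stable form a subgroup normalized by t, because t permutes
    the generators. Then all g with g t^(- h g) in N form a subgroup, which
    contains the generators of F. *)
Lemma ker_ind (P : F -> Prop) : P 1%g ->
  (forall b k, h k = 0 -> P k -> P (y b * k)%g) ->
  (forall b k, h k = 0 -> P (y b * k)%g -> P k) ->
  forall k, h k = 0 -> P k.
Proof.
pose stable (Q : F -> Prop) g := forall k, h k = 0 -> Q k <-> Q (g * k)%g.
pose N g := h g = 0 /\ forall Q, (forall b, stable Q (y b)) -> stable Q g.
have N1 : N 1%g by split=> [|Q _ k _]; rewrite ?(h1 hM) ?mul1g.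
have NM g g' : N g -> N g' -> N (g * g')%g.
  move=> [hg Ng] [hg' Ng']; split=> [|Q Qy k hk]; first by rewrite hM hg hg'.
  by rewrite -mulgA (Ng' Q Qy k hk); apply: Ng; rewrite // hM hg' hk.
have NV g : N g -> N g^-1%g.
  move=> [hg Ng]; have hgV : h g^-1%g = 0 by rewrite (hV hM) hg oppr0.
  split=> // Q Qy k hk; rewrite -[k in Q k <-> _](mulVKg g).
  by apply: iff_sym; apply: Ng; rewrite // hM hgV hk.
have Ny b : N (y b) by split=> [|Q]; [apply: h_ker_gen | apply].
have NJ m g : N g -> N (zpow t m * g * (zpow t m)^-1)%g.
  move=> [hg Ng]; split=> [|Q Qy k hk]; first by rewrite h_conj.
  pose Q' k' := Q (zpow t m * k' * (zpow t m)^-1)%g.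
  have Q'y b : stable Q' (y b).
    move=> k' hk'; rewrite /Q'.
    have -> : (zpow t m * (y b * k') * (zpow t m)^-1 =
        y (translate m b) * (zpow t m * k' * (zpow t m)^-1))%g.
      by rewrite -ker_gen_translate !mulgA mulgVK.
    by apply: Qy; rewrite h_conj.
  pose k' := (zpow t (- m) * k * (zpow t (- m))^-1)%g.
  have hk' : h k' = 0 by rewrite h_conj.
  have := Ng Q' Q'y k' hk'; rewrite /Q' /k' zpowN invgK.
  by rewrite !mulgA mulgV mul1g !mulgK.
have all_N g : N (g * zpow t (- h g))%g.
  elim/(free_ind x_free): g => [|u v Nu Nv|u Nu|i].
  - by rewrite (h1 hM) mulg1.
  - have := NM _ _ Nu (NJ (h u) _ Nv).
    rewrite !zpowN -!mulgA mulKg => e; rewrite hM zpowD invgM.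
    exact: e.
  - have := NJ (- h u) _ (NV _ Nu).
    by rewrite (hV hM) opprK !zpowN invgM !invgK mulgA mulVg mul1g.
  - have [->|ii0] := eqVneq i i0; first by rewrite h_i0 zpowN zpow1 mulgV.
    by rewrite h_j // mulg1 -(ker_gen0 (Sub i ii0)).
move=> P1 Pup Pdn k hk; have [_ Nk] := all_N k.
have Py b : stable P (y b) by move=> k' hk'; split; [apply: Pup | apply: Pdn].
have := Nk P Py 1%g (h1 hM); rewrite hk oppr0 zpow0 !mulg1.
by case=> + _; apply.
Qed.

(** The substitution of translate m b for b in series. *)
Definition precomp m (f : seq B -> int) (w : seq B) : int :=
  f (map (translate (- m)) w).

Lemma precompK m : cancel (precomp m) (precomp (- m)).
Proof.
move=> f; apply/funext=> w; rewrite /precomp -map_comp map_id_in // => b _ /=.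
by rewrite translateNK.
Qed.

Lemma precompNK m : cancel (precomp (- m)) (precomp m).
Proof. by move=> f; have := precompK (- m) f; rewrite opprK. Qed.

Definition shiftP : permt (seq B -> int) := Permt (precompK 1) (precompNK 1).

Lemma zpow_shiftP m f : pfun (zpow shiftP m) f = precomp m f.
Proof.
have precompS k : precomp (k + 1) f = precomp 1 (precomp k f).
  apply/funext=> w; rewrite /precomp -map_comp; congr f; apply: eq_map => b /=.
  by rewrite /translate /=; congr pair; ring.
elim/int_shift_ind: m => [|m IHm|m].
- by apply/funext=> w; rewrite /precomp map_id_in // => -[j n] _; rewrite /translate /= addr0.
- by rewrite zpowS precompS -IHm.
rewrite zpowS precompS => /= e.
exact: (can_inj (precompK 1)).
Qed.

Lemma lmulP_conj m b :
  (zpow shiftP m * lmulP b * (zpow shiftP m)^-1)%g = lmulP (translate m b).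
Proof.
apply: (mulIg (zpow shiftP m)); rewrite mulgVK.
apply: permt_eq; apply/funext=> f /=; rewrite !zpow_shiftP; apply/funext=> w.
rewrite /precomp /lmul; congr (_ + _); case: w => [//|a w] /=.
by rewrite (can2_eq (translateK _) (translateNK _)) opprK.
Qed.

(** The free group acts on series: t by translation of the letters and the
    other generators x_j by multiplication by 1 + (j, 0). Then y b acts by
    multiplication by 1 + b, and applying k to the series 1 gives its
    expansion. *)
Lemma exists_magnus : exists c : F -> seq B -> int,
  c 1%g = @delta B /\ forall b k, c (y b * k)%g = lmul b (c k).
Proof.
pose gen (i : I) : permt (seq B -> int) :=
  if insub i is Some j then lmulP (j, 0) else shiftP.
have [rho rhoE _] := x_free gen.
exists (fun g => pfun (rho g) (@delta B)); split; first by rewrite morph_one.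
move=> b k.
rewrite !gmulfM morph_inv !zpow_morph !rhoE /gen insubF ?eqxx // valK.
by rewrite lmulP_conj /translate /= add0r -surjective_pairing.
Qed.

(** Modulo conjugation by the kernel, which is invisible in degree one,
    conjugation by g is conjugation by a power of t. *)
Lemma coef_conj_gen c : c 1%g = @delta B ->
  (forall b k, c (y b * k)%g = lmul b (c k)) ->
  forall g b a, c (g * y b * g^-1)%g [:: a] = (a == translate (h g) b)%:R.
Proof.
move=> c1 c_y g b a; pose k := (g * zpow t (- h g))%g.
have hk : h k = 0 by rewrite hM h_zpow h_i0 mulr1 subrr.
have -> : (g * y b * g^-1 = k * y (translate (h g) b) * k^-1)%g.
  by rewrite -ker_gen_translate /k zpowN invgM invgK !mulgA mulgVK mulgVK.
by rewrite (coef1J hM ker_ind c1 c_y) ?h_ker_gen // (coef1_y c1 c_y).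
Qed.

End Kernel.

(** * The invariant bi-ordering *)

Theorem theorem3p6 (I : choiceType) (F : groupType) (x : I -> F)
  (x_free : freely_generates x)
  (phi : {multiplicative F -> F}) (phi_bij : bijective phi)
  (w : I -> F)
  (sigma sigmaV : I -> I)
  (sigmaK : cancel sigma sigmaV) (sigmaVK : cancel sigmaV sigma)
  (phi_x : forall i, phi (x i) = (w i * x (sigma i) * (w i)^-1)%g)
  (i0 : I) (sigma_i0 : sigma i0 = i0)
  (h : F -> int)
  (hM : forall u v : F, h (u * v)%g = h u + h v)
  (h_i0 : h (x i0) = 1)
  (h_j : forall j, j != i0 -> h (x j) = 0)
  (orbit_gcd : forall i, let O := orbitz sigma sigmaV i in
     finite_set O ->
     gcdz (#|` fset_set O|%fset)%:Z (\sum_(j \in O) h (w j)) = 1) :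
  exists lt : rel F, bi_ordering lt /\ invariant_under phi lt.
Proof.
(* The order on the basis of the kernel is induced from I x Z. *)
have [ltI [[ltI_irr ltI_trans ltI_tot] ltI_skew ltI_shift]] :=
  exists_skew_order sigmaK sigmaVK orbit_gcd.
pose J := {i : I | i != i0}; pose B := (J * int)%type.
pose emb (b : B) : I * int := (val b.1, b.2).
have emb_inj : injective emb by move=> [j n] [j' n'] [/val_inj -> ->].
pose lt (b b' : B) := ltI (emb b) (emb b').
have lt_st : strict_total lt.
  split=> [b|b b' b''|b b' bb']; [exact: ltI_irr | exact: ltI_trans |].
  by apply: ltI_tot; rewrite (inj_eq emb_inj).
have [c [c1 c_y]] := exists_magnus x_free i0.
have h_y := h_ker_gen hM h_j.
have coef_conj := coef_conj_gen x_free hM h_i0 h_j c1 c_y.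
have conj_shift g : order_shift h (ker_gen x (i0 := i0)) c lt (fun k => g * k * g^-1)%g.
  split=> [u v|k|]; first by rewrite !mulgA mulgVK.
    exact: h_conj.
  exists (translate (h g)), (translate (- h g)); split=> //.
  - exact: translateK.
  - exact: translateNK.
  - by move=> a b; apply: ltI_shift.
have [ltF [ltF_bi ltF_inv]] := magnus_bi_ordering hM h_y
  (ker_ind x_free hM h_i0 h_j) c1 c_y lt_st conj_shift.
exists ltF; split=> //; apply: ltF_inv.
have sigmaV_i0 : sigmaV i0 = i0 by rewrite -[in LHS]sigma_i0 sigmaK.
have h_phi g : h (phi g) = h g.
  elim/(free_ind x_free): g => [|u v hu hv|u hu|i].
  - by rewrite morph_one.
  - by rewrite gmulfM !hM hu hv.
  - by rewrite morph_inv !(hV hM) hu.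
  rewrite phi_x h_conj //; have [->|ii0] := eqVneq i i0; first by rewrite sigma_i0.
  by rewrite !h_j // -sigma_i0 (can_eq sigmaK).
have sJ_proof (j : J) : sigma (val j) != i0.
  by apply: contra (valP j) => /eqP/(congr1 sigmaV); rewrite sigmaK sigmaV_i0 => ->.
have sJV_proof (j : J) : sigmaV (val j) != i0.
  by apply: contra (valP j) => /eqP/(congr1 sigma); rewrite sigmaVK sigma_i0 => ->.
pose sJ j : J := Sub (sigma (val j)) (sJ_proof j).
pose sJV j : J := Sub (sigmaV (val j)) (sJV_proof j).
have sJK : cancel sJ sJV by move=> j; apply: val_inj; rewrite /= sigmaK.
have sJVK : cancel sJV sJ by move=> j; apply: val_inj; rewrite /= sigmaVK.
pose aJ (j : J) := h (w (val j)).
split=> [u v|//|]; first exact: gmulfM.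
exists (skew sJ aJ), (skewV sJV aJ); split.
- exact: skewK.
- exact: skewVK.
- by move=> a b; apply: (ltI_skew (emb a) (emb b)).
move=> [j n] a; pose g := (zpow (phi (x i0)) n * w (val j))%g.
(* As phi t is conjugate to t, the image of y (j, n) is conjugate to
   y (sigma j, 0) by an element g with h g = n + h (w j). *)
have -> : phi (ker_gen x (j, n)) = (g * ker_gen x (sJ j, 0) * g^-1)%g.
  rewrite ker_gen0 /ker_gen /= !gmulfM morph_inv zpow_morph (phi_x (val j)).
  by rewrite /g invgM !mulgA.
by rewrite coef_conj /g hM (h_zpow hM) h_phi h_i0 mulr1 /translate /= add0r.
Qed.
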